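(* Let $l,k\ge 2$ be integers and let $G_1,\ldots,G_l$ be connected $k$-symmetric graphs. Then the graph $G=\overline{K}_k\vee_k(G_1\cup\cdots\cup G_l)$ is 2-connected and prime with respect to the Cartesian product.
   Context: A finite simple graph $H$ is $k$-symmetric if $\mathrm{Aut}(H)$ contains a subgroup isomorphic to $\mathbb{Z}_k$ acting freely on $V(H)$; a generator $\varphi$ of such a subgroup is a $k$-symmetric automorphism, and a base of $\varphi$ is a subset $B\subseteq V(H)$ containing exactly one vertex from each $\langle\varphi\rangle$-orbit. The graph $G=\overline{K}_k\vee_k(G_1\cup\cdots\cup G_l)$ is defined as follows, for arbitrary choices of $k$-symmetric automorphisms $\varphi_i$ of $G_i$ and bases $B_i$ of $\varphi_i$: take the disjoint union of $G_1,\ldots,G_l$ together with $k$ new pairwise nonadjacent vertices $u_j$, $j\in\mathbb{Z}_k$, and for each $j\in\mathbb{Z}_k$ and each $i$ join $u_j$ to every vertex of $\varphi_i^j(B_i)$; no other edges are added. A graph is 2-connected if removing fewer than 2 vertices never leaves a disconnected or trivial graph. A graph is prime with respect to the Cartesian product if it is not isomorphic to a Cartesian product of two graphs each with at least two vertices. *)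

(* Defs.v *)
From mathcomp Require Import all_boot all_order all_fingroup all_algebra all_solvable.

Set Implicit Arguments.
Unset Strict Implicit.
Unset Printing Implicit Defensive.

Record sgraph := SGraph {
  vertex :> finType;
  adj : rel vertex;
  adj_sym : symmetric adj;
  adj_irrefl : irreflexive adj }.

Definition connected (G : sgraph) : Prop :=
  0 < #|G| /\ forall x y : G, connect (@adj G) x y.

Section Induced.
Variables (G : sgraph) (A : {set G}).

Definition induced_adj : rel {x : G | x \in A} :=
  fun x y => adj (val x) (val y).

Fact induced_sym : symmetric induced_adj.
Proof. by move=> x y; apply: adj_sym. Qed.

Fact induced_irrefl : irreflexive induced_adj.
Proof. by move=> x; apply: adj_irrefl. Qed.

Definition induced : sgraph := SGraph induced_sym induced_irrefl.

End Induced.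

(* Deleting fewer than n vertices leaves a connected graph that is not a      *)
(* single vertex.                                                             *)
Definition n_connected (n : nat) (G : sgraph) : Prop :=
  forall S : {set G}, #|S| < n ->
    connected (induced (~: S)) /\ 1 < #|induced (~: S)|.

Definition isomorphic (G H : sgraph) : Prop :=
  exists2 f : G -> H, bijective f & forall x y, adj (f x) (f y) = adj x y.

Section CartesianProduct.
Variables G H : sgraph.

Definition cart_adj : rel (G * H) := fun x y =>
  ((x.1 == y.1) && adj x.2 y.2) || ((x.2 == y.2) && adj x.1 y.1).

Fact cart_sym : symmetric cart_adj.
Proof.
move=> x y; rewrite /cart_adj.
by rewrite (eq_sym x.1) (eq_sym x.2) (adj_sym x.1) (adj_sym x.2).
Qed.

Fact cart_irrefl : irreflexive cart_adj.
Proof. by move=> x; rewrite /cart_adj !adj_irrefl !andbF. Qed.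

Definition cart_prod : sgraph := SGraph cart_sym cart_irrefl.

End CartesianProduct.

Definition cart_prime (G : sgraph) : Prop :=
  ~ exists H1 H2 : sgraph,
      [/\ 1 < #|H1|, 1 < #|H2| & isomorphic G (cart_prod H1 H2)].

Definition graph_aut (H : sgraph) : {set {perm H}} :=
  [set s : {perm H} | [forall x, forall y, adj (s x) (s y) == adj x y]].

(* For k > 0, Zp k is the cyclic group of order k (the case k = 1 included).  *)
Definition k_symmetric_subgroup (k : nat) (H : sgraph)
    (K : {group {perm H}}) : Prop :=
  [/\ K \subset graph_aut H, (K \isog Zp k)%g
    & forall (s : {perm H}) (x : H), s \in K -> s x = x -> s = 1%g].

Definition k_symmetric (k : nat) (H : sgraph) : Prop :=
  exists K : {group {perm H}}, k_symmetric_subgroup k K.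

Definition k_symmetric_automorphism (k : nat) (H : sgraph)
    (phi : {perm H}) : Prop :=
  exists2 K : {group {perm H}}, k_symmetric_subgroup k K & generator K phi.

Definition is_base (H : sgraph) (phi : {perm H}) (B : {set H}) : Prop :=
  forall O : {set H}, O \in porbits phi -> #|B :&: O| = 1.

Section DisjointUnion.
Variables (l : nat) (G : 'I_l -> sgraph).

(* When tag x = tag y, tagged_as x y is tagged y transported to G (tag x).    *)
Definition dunion_adj : rel {i : 'I_l & G i} := fun x y =>
  (tag x == tag y) && adj (tagged x) (tagged_as x y).

Fact dunion_sym : symmetric dunion_adj.
Proof.
move=> [i x] [j y]; rewrite /dunion_adj /=.
have [eq_ij|] := eqVneq i j; last by [].
by case: j / eq_ij y => y; rewrite !tagged_asE adj_sym.
Qed.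

Fact dunion_irrefl : irreflexive dunion_adj.
Proof. by move=> [i x]; rewrite /dunion_adj tagged_asE adj_irrefl andbF. Qed.

Definition dunion : sgraph := SGraph dunion_sym dunion_irrefl.

End DisjointUnion.

Section KJoin.
Variables (k l : nat) (G : 'I_l -> sgraph).
Variables (phi : forall i, {perm G i}) (B : forall i, {set G i}).

(* The vertex inl j is u_j; Z_k is represented by 'I_k, which is harmless as  *)
(* phi i ^+ j only depends on j modulo k when phi i has order k.              *)
Definition kjoin_adj : rel ('I_k + dunion G) := fun a b =>
  match a, b with
  | inl _, inl _ => false
  | inl j, inr x | inr x, inl j =>
      tagged x \in [set (phi (tag x) ^+ j)%g z | z in B (tag x)]
  | inr x, inr y => adj x y
  end.

Fact kjoin_sym : symmetric kjoin_adj.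
Proof. by move=> [j|x] [j'|y] //=; apply: dunion_sym. Qed.

Fact kjoin_irrefl : irreflexive kjoin_adj.
Proof. by move=> [j|x] //=; apply: dunion_irrefl. Qed.

Definition kjoin : sgraph := SGraph kjoin_sym kjoin_irrefl.

End KJoin.

(* Main.v *)
Require Import Defs.
From mathcomp Require Import all_boot all_order all_fingroup all_algebra all_solvable.

Set Implicit Arguments.
Unset Strict Implicit.
Unset Printing Implicit Defensive.

(** Every vertex of every G_i has exactly one neighbour among the u_j, and every
    u_j has a neighbour in every G_i.  After deleting one vertex some G_i is
    intact and still reachable from everywhere.  For primality, two edges at a
    vertex of a Cartesian product that lie in different factors span a square,
    whereas two edges u_j x and u_j y with x and y in different G_i do not; so
    all the edges at u_j lie in a single factor, and the product is
    disconnected. *)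

Lemma exists_ord_neq (n : nat) (i : 'I_n) : 1 < n -> exists j, j != i.
Proof.
move=> n_gt1; have : 0 < #|predC1 i| by rewrite cardC1 card_ord -subn1 subn_gt0.
by case/card_gt0P => j; exists j.
Qed.

(** Edges are only required to map to connected pairs, so that [h] may collapse an edge, as the
    projections of a product do. *)
Lemma connect_homo (T U : finType) (e : rel T) (e' : rel U) (h : T -> U) :
  (forall x y, e x y -> connect e' (h x) (h y)) ->
  forall x y, connect e x y -> connect e' (h x) (h y).
Proof.
move=> hom x _ /connectP [p px ->].
elim: p x px => [|z p IHp] x /=; first by rewrite connect0.
by case/andP=> /hom xz /IHp; apply: connect_trans.
Qed.

Lemma connect_adj_sym (G : sgraph) : connect_sym (@adj G).
Proof. exact/sym_connect_sym/adj_sym. Qed.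

Lemma n_connected_connect (n : nat) (G : sgraph) (x y : G) :
  0 < n -> n_connected n G -> connect (@adj G) x y.
Proof.
move=> n_gt0 /(_ set0); rewrite cards0 => /(_ n_gt0) [[_ conn] _].
have inT z : z \in (~: set0 : {set G}) by rewrite setC0 inE.
have := conn (exist _ x (inT x)) (exist _ y (inT y)).
by apply: (connect_homo (h := val)) => a b ab; apply: connect1.
Qed.

Section Base.
Variables (k : nat) (H : sgraph) (phi : {perm H}) (B : {set H}).
Hypotheses (k_gt0 : 0 < k) (hphi : k_symmetric_automorphism k phi).
Hypothesis hB : is_base phi B.

Lemma symmetric_automorphism_order : #[phi]%g = k.
Proof.
case: hphi => K [_ isoK _] /eqP eqK.
by rewrite orderE -eqK (card_isog isoK) card_Zp.
Qed.

Lemma symmetric_automorphism_free (n : nat) (x : H) :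
  (phi ^+ n)%g x = x -> (phi ^+ n = 1)%g.
Proof.
case: hphi => K [_ _ free] /eqP eqK; apply: free.
by rewrite eqK mem_cycle.
Qed.

Lemma base_porbit (x : H) : exists b, B :&: porbit phi x = [set b].
Proof. by apply/cards1P/eqP/hB/imset_f. Qed.

(** If [b] is the base point in the orbit of [x], then [x] is the image of [b] under some power of
    [phi], and the exponent may be reduced modulo the order [k]. *)
Lemma base_cover (x : H) :
  exists j : 'I_k, x \in [set (phi ^+ j)%g z | z in B].
Proof.
have [b Bb] := base_porbit x.
have /setIP [bB b_x] : b \in B :&: porbit phi x by rewrite Bb set11.
move: b_x; rewrite porbit_sym => /porbitP [n def_x].
exists (Ordinal (ltn_pmod n k_gt0)); apply/imsetP; exists b => //=.
by rewrite /= -{1}symmetric_automorphism_order expg_mod_order.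
Qed.

(** Both preimages of [x] lie in its orbit, so they are the same base point [d]. Then a power of
    [phi] with exponent below [k] fixes [d]; freeness makes it trivial, and the order forces the
    exponent to be 0. *)
Lemma base_disjoint (x : H) (i j : 'I_k) :
  x \in [set (phi ^+ i)%g z | z in B] ->
  x \in [set (phi ^+ j)%g z | z in B] -> i = j.
Proof.
move=> /imsetP [b bB def_b] /imsetP [c cB def_c].
have [d Bd] := base_porbit x.
have orb (n : nat) z : x = (phi ^+ n)%g z -> z \in porbit phi x.
  by move=> ->; rewrite porbit_sym mem_porbit.
have /set1P eq_bd : b \in [set d] by rewrite -Bd inE bB (orb _ _ def_b).
have /set1P eq_cd : c \in [set d] by rewrite -Bd inE cB (orb _ _ def_c).
(* Natural subtraction truncates, so [j - i] is a meaningful exponent only when [i <= j]. *)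
wlog le_ij : i j b c bB cB def_b def_c eq_bd eq_cd / i <= j.
  move=> IH; case: (leqP i j) => [|/ltnW] le; first exact: (IH i j b c).
  by apply/esym; apply: (IH j i c b).
have fix_d : (phi ^+ (j - i))%g d = d.
  apply: (@perm_inj _ (phi ^+ i)%g).
  by rewrite -permM -expgD subnK // -{1}eq_cd -def_c def_b eq_bd.
have := symmetric_automorphism_free fix_d.
move/eqP; rewrite -order_dvdn symmetric_automorphism_order => k_dvd.
apply/val_inj/eqP; rewrite eqn_leq le_ij -subn_eq0 /=.
by move: k_dvd; rewrite /dvdn modn_small // (leq_ltn_trans (leq_subr _ _)).
Qed.

Lemma base_meet (j : 'I_k) :
  0 < #|H| -> exists x, x \in [set (phi ^+ j)%g z | z in B].
Proof.
case/card_gt0P => y _; have [i /imsetP [b bB _]] := base_cover y.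
by exists ((phi ^+ j)%g b); apply: imset_f.
Qed.

End Base.

Section KJoinTheory.
Variables (l k : nat) (hl : 2 <= l) (hk : 2 <= k).
Variable G : 'I_l -> sgraph.
Hypothesis Gconn : forall i : 'I_l, connected (G i).
Variable phi : forall i : 'I_l, {perm (G i)}.
Hypothesis hphi : forall i : 'I_l, k_symmetric_automorphism k (phi i).
Variable B : forall i : 'I_l, {set (G i)}.
Hypothesis hB : forall i : 'I_l, is_base (phi i) (B i).

Local Notation J := (kjoin k phi B).
Local Notation u j := (inl j : J).
Local Notation v x := (inr x : J).
Local Notation inG := (Tagged (fun i => G i) : _ -> dunion G).

Let k_gt0 : 0 < k. Proof. exact: ltnW. Qed.

Lemma kjoin_apex_exists (x : dunion G) : exists j, adj (u j) (v x).
Proof. exact: (base_cover k_gt0 (@hphi (tag x)) (@hB (tag x)) (tagged x)). Qed.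

Lemma kjoin_apex_unique (x : dunion G) (i j : 'I_k) :
  adj (u i) (v x) -> adj (u j) (v x) -> i = j.
Proof. exact: (base_disjoint k_gt0 (@hphi (tag x)) (@hB (tag x))). Qed.

Lemma kjoin_apex_neighbour (j : 'I_k) (i : 'I_l) :
  exists x : G i, adj (u j) (v (inG x)).
Proof.
by have [n _] := Gconn i; apply: (base_meet k_gt0 (@hphi i) (@hB i) j n).
Qed.

Lemma kjoin_2connected : n_connected 2 J.
Proof.
move=> S S_lt2.
have S_sub a b : a \in S -> b \in S -> a = b.
  by move=> aS bS; apply: (card_le1_eqP (A := S)).
pose A := ~: S; set I := induced A.
pose ex a (aA : a \in A) : I := exist _ a aA.
have conn_piece i (iA : forall x : G i, v (inG x) \in A) x y :
    connect (@adj I) (ex _ (iA x)) (ex _ (iA y)).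
  apply: (@connect_homo _ _ (@adj (G i)) _ (fun x => ex _ (iA x))).
    by move=> {}x {}y xy; apply: connect1; rewrite /= /induced_adj /= /dunion_adj tagged_asE eqxx.
  by case: (Gconn i) => _; apply.
(* Choose a piece that the deletion leaves intact; its vertex [x0] will serve as the hub to which
   everything is connected. *)
have [i iA] : exists i, forall x : G i, v (inG x) \in A.
  case: (set_0Vmem S) => [S0|[a aS]].
    by exists (Ordinal (ltnW hl)) => x; rewrite /A S0 !inE.
  have [i neq_i] : exists i, forall x : G i, v (inG x) != a.
    case: a aS => [j _|[i' y] _]; first by exists (Ordinal (ltnW hl)).
    have [i ne] := exists_ord_neq i' hl; exists i => x.
    apply: contraNneq ne.
    (* The value [i'] at the apices is a dummy: both sides of the equation are [inr]. *)
    by move/(congr1 (fun t : J => if t is inr z then tag z else i')) => /= ->.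
  exists i => x; rewrite inE; apply: contra (neq_i x) => xS.
  by rewrite (S_sub _ _ xS aS).
have [x0 _] := kjoin_apex_neighbour (Ordinal k_gt0) i.
have adj_conn a b (aA : a \in A) (bA : b \in A) :
  adj a b -> connect (@adj I) (ex a aA) (ex b bA).
  by move=> ab; apply: connect1.
have from_u j (jA : u j \in A) : connect (@adj I) (ex _ jA) (ex _ (iA x0)).
  have [x jx] := kjoin_apex_neighbour j i.
  exact: connect_trans (adj_conn _ _ _ (iA x) jx) (conn_piece _ _ _ _).
have to_x0 a (aA : a \in A) : connect (@adj I) (ex a aA) (ex _ (iA x0)).
  case: a aA => [j|[i' x]] xA; first exact: from_u.
  have [c cx] := kjoin_apex_exists (inG x).
  (* If the apex [u c] of [x] survives, it leads to the hub. Otherwise it is the only deleted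
     vertex, so the piece of [x] is intact and can be crossed to a neighbour of another apex. *)
  case: (boolP (u c \in A)) => cA.
    by apply: connect_trans (from_u c cA); apply: adj_conn; rewrite adj_sym.
  have cS : u c \in S by move: cA; rewrite inE negbK.
  have iA' y : v (inG y) \in A.
    by rewrite inE; apply/negP => yS; have := S_sub _ _ cS yS.
  have [j ne_jc] := exists_ord_neq c hk.
  have jA : u j \in A.
    by rewrite inE; apply: contra ne_jc => jS; have [->] := S_sub _ _ jS cS.
  have [y jy] := kjoin_apex_neighbour j i'.
  apply: connect_trans (from_u j jA).
  rewrite (bool_irrelevance xA (iA' _ x)).
  apply: connect_trans (conn_piece _ (iA' i') x y) _.
  by apply: adj_conn; rewrite adj_sym.
have I_gt1 : 1 < #|I|.
  have cardI : #|I| = #|A| by rewrite card_sig.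
  (* There are [k >= 2] apices and at least the vertex [x0], hence at least 3 vertices, of which at
     most one is deleted. *)
  have : 2 < #|S| + #|A|.
    rewrite cardsC card_sum card_ord -addn1 leq_add //.
    by apply/card_gt0P; exists (inG x0).
  by rewrite cardI -[1 < _]ltnS => /leq_trans; apply; rewrite -add1n leq_add2r.
split=> //; split; first exact: ltnW.
move=> [a aA] [b bA]; apply: connect_trans (to_x0 a aA) _.
by rewrite connect_adj_sym; apply: to_x0.
Qed.

(** A vertex of the disjoint union has its non-apex neighbours in its own piece, so [a] must be an
    apex, and the apex adjacent to [x] is unique. *)
Lemma kjoin_common_neighbour (a : J) (j : 'I_k) (x y : dunion G) :
  tag x != tag y -> adj (u j) (v x) -> adj a (v x) -> adj a (v y) -> a = u j.
Proof.
move=> ne_xy jx; case: a => [i ix _|z /=].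
  by rewrite (kjoin_apex_unique ix jx).
move=> /andP [/eqP eq_zx _] /andP [/eqP eq_zy _].
by rewrite -eq_zx -eq_zy eqxx in ne_xy.
Qed.

End KJoinTheory.

Lemma connect_cart_fst (H1 H2 : sgraph) (x y : cart_prod H1 H2) :
  connect (@adj (cart_prod H1 H2)) x y -> connect (@adj H1) x.1 y.1.
Proof.
apply: (connect_homo (h := fst)) => z t /orP [/andP [/eqP -> _] //|].
by case/andP => _; apply: connect1.
Qed.

Lemma connect_cart_snd (H1 H2 : sgraph) (x y : cart_prod H1 H2) :
  connect (@adj (cart_prod H1 H2)) x y -> connect (@adj H2) x.2 y.2.
Proof.
apply: (connect_homo (h := snd)) => z t /orP [|/andP [/eqP -> _] //].
by case/andP => _; apply: connect1.
Qed.

Lemma connect_neighbour (H : sgraph) (x : H) :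
  1 < #|H| -> (forall y, connect (@adj H) x y) -> exists y, adj x y.
Proof.
move=> H_gt1 conn.
have /card_gt0P [y ne_yx] : 0 < #|predC1 x| by rewrite cardC1 -subn1 subn_gt0.
have /connectP [[|z p] /= xp def_y] := conn y; last by exists z; case/andP: xp.
by rewrite def_y inE eqxx in ne_yx.
Qed.

Theorem theorem4p6 (l k : nat) (hl : 2 <= l) (hk : 2 <= k)
  (G : 'I_l -> sgraph)
  (Gconn : forall i : 'I_l, connected (G i))
  (Gsym : forall i : 'I_l, k_symmetric k (G i))
  (phi : forall i : 'I_l, {perm (G i)})
  (hphi : forall i : 'I_l, k_symmetric_automorphism k (phi i))
  (B : forall i : 'I_l, {set (G i)})
  (hB : forall i : 'I_l, is_base (phi i) (B i)) :
  n_connected 2 (kjoin k phi B) /\ cart_prime (kjoin k phi B).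
Proof.
have conn2 := kjoin_2connected hl hk Gconn hphi hB; split=> //.
case=> H1 [H2 [H1_gt1 H2_gt1 [f [g fK gK] f_adj]]].
set J := kjoin k phi B in f g fK gK f_adj conn2.
pose o := Ordinal (ltnW hk); pose u : J := inl o.
have adj_g p q : adj (g p) (g q) = adj p q by rewrite -f_adj !gK.
have conn_prod p q : connect (@adj (cart_prod H1 H2)) p q.
  rewrite -(gK p) -(gK q).
  apply: (connect_homo (h := f)) (n_connected_connect (g p) (g q) _ conn2) => //.
  by move=> x y xy; apply: connect1; rewrite f_adj.
case def_fu: (f u) => [a b]; have gu : g (a, b) = u by rewrite -def_fu fK.
have [a' aa'] : exists a', adj a a'.
  apply: connect_neighbour => // a'.
  exact: (connect_cart_fst (conn_prod (a, b) (a', b))).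
have [b' bb'] : exists b', adj b b'.
  apply: connect_neighbour => // b'.
  exact: (connect_cart_snd (conn_prod (a, b) (a, b'))).
have apex_nb p : adj ((a, b) : cart_prod H1 H2) p ->
    exists x : dunion G, g p = inr x.
  by rewrite -adj_g gu; case: (g p) => [//|x] _; exists x.
(* The corner [(c, d)] is adjacent to both [(c, b)] and [(a, d)]. If these lay in different pieces,
   it would coincide with the opposite corner [(a, b)], making [c] equal to [a] and hence adjacent
   to itself. *)
have no_square c d x y : adj a c -> adj b d ->
    g (c, b) = inr x -> g (a, d) = inr y -> tag x = tag y.
  move=> ac bd gx gy; apply/eqP/negPn/negP => ne_xy.
  have : g (c, d) = u.
    apply: (kjoin_common_neighbour hk hphi hB ne_xy).
    - by rewrite -gx -/u -gu adj_g /= /cart_adj /= eqxx ac orbT.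
    - by rewrite -gx adj_g /= /cart_adj /= eqxx adj_sym bd.
    - by rewrite -gy adj_g /= /cart_adj /= eqxx adj_sym ac orbT.
  by rewrite -gu => /(can_inj gK) [eq_ca _]; rewrite eq_ca adj_irrefl in ac.
have [x gx] : exists x : dunion G, g (a', b) = inr x.
  by apply: apex_nb; rewrite /= /cart_adj /= eqxx aa' orbT.
have [y gy] : exists y : dunion G, g (a, b') = inr y.
  by apply: apex_nb; rewrite /= /cart_adj /= eqxx bb'.
have eq_xy := no_square _ _ _ _ aa' bb' gx gy.
(* The apex [u] has a neighbour [w] in a piece other than that of [x] and [y]. The edge from [u] to
   [w] lies in one factor; comparing it with the edge to [x] or [y] in the other factor puts [w] in
   their piece, a contradiction. *)
have [i ne_ix] := exists_ord_neq (tag x) hl.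
have [z] := kjoin_apex_neighbour hk Gconn hphi hB o i.
rewrite -/J -/u -f_adj def_fu; set w : J := inr _.
have gw : g (f w) = w by rewrite fK.
case: (f w) gw => c d gw /orP [] /= /andP [/eqP eq_ab adj_cd].
  subst c; have := no_square _ _ _ _ aa' adj_cd gx gw => /= eq_xi.
  by rewrite eq_xi eqxx in ne_ix.
subst d; have := no_square _ _ _ _ adj_cd bb' gw gy => /= eq_iy.
by rewrite eq_xy eq_iy eqxx in ne_ix.
Qed.
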